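(* Let $\mathcal F=(F_1,F_2)$ be a pair of finite (possibly empty) sets of positive integers, let $k_i$ be the number of elements of $F_i$ ($i=1,2$), and let $k=k_1+k_2$. Let $\alpha$ be a real number with $\alpha\neq -1,-2,\dots$. If $\alpha+k>-1$ and $\Omega_{\mathcal F}^{\alpha}(x)\neq 0$ for all real $x\ge 0$, then $\alpha+1$ and $\mathcal F$ are admissible.
   Context: $\mathbb N=\{0,1,2,\dots\}$. For $\alpha\in\mathbb C\setminus\{-1,-2,\dots\}$ and $n\in\mathbb N$, the Laguerre polynomials are $L_n^{\alpha}(x)=\sum_{j=0}^n\frac{(-x)^j}{j!}\binom{n+\alpha}{n-j}$. Polynomial $\Omega^\alpha_{\mathcal F}$: $\Omega_{\mathcal F}^{\alpha}(x)$ is the determinant of the $k\times k$ matrix whose first $k_1$ rows are, for $f\in F_1$ (in increasing order), $$\bigl(L_f^{\alpha}(x),\ (L_f^{\alpha})'(x),\ \dots,\ (L_f^{\alpha})^{(k-1)}(x)\bigr),$$ and whose last $k_2$ rows are, for $f\in F_2$ (in increasing order), $$\bigl(L_f^{\alpha}(-x),\ L_f^{\alpha+1}(-x),\ \dots,\ L_f^{\alpha+k-1}(-x)\bigr).$$ (If $k=0$ the determinant is $1$.) Admissibility: for a real number $c\neq 0,-1,-2,\dots$, write $\hat c=\max\{-[c],0\}$, where $[c]=\max\{s\in\mathbb Z: s\le c\}$. We say that $c$ and $\mathcal F=(F_1,F_2)$ are admissible if for all $n\in\mathbb N$ $$\frac{\prod_{f\in F_1}(n-f)\prod_{f\in F_2}(n+c+f)}{(n+c)_{\hat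 c}}\ge 0,$$ where $(a)_0=1$ and $(a)_j=a(a+1)\cdots(a+j-1)$ for $j\ge1$. *)

(* Defs.v *)
From HB Require Import structures.
From mathcomp Require Import all_boot all_order all_algebra.
From mathcomp Require Import finmap reals.

Set Implicit Arguments.
Unset Strict Implicit.
Unset Printing Implicit Defensive.

Import Order.TTheory GRing.Theory Num.Theory.

Local Open Scope ring_scope.

Definition gbinom (K : numFieldType) (a : K) (m : nat) : K :=
  (\prod_(i < m) (a - i%:R)) / m`!%:R.

Definition pochhammer (K : numFieldType) (a : K) (j : nat) : K :=
  \prod_(i < j) (a + i%:R).

Definition laguerre (K : numFieldType) (n : nat) (alpha : K) : {poly K} :=
  \sum_(j < n.+1) ((j`!%:R)^-1 * gbinom (n%:R + alpha) (n - j)) *: (- 'X) ^+ j.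

Definition incr_enum (F : {fset nat}) : seq nat := sort leq (enum_fset F).

Definition Omega (K : numFieldType) (alpha : K) (F1 F2 : {fset nat}) : {poly K} :=
  let k1 := #|` F1|%fset in
  let k2 := #|` F2|%fset in
  \det (col_mx
    (\matrix_(i < k1, j < k1 + k2)
       (laguerre (nth 0%N (incr_enum F1) i) alpha)^`(j))
    (\matrix_(i < k2, j < k1 + k2)
       (laguerre (nth 0%N (incr_enum F2) i) (alpha + j%:R) \Po (- 'X)))).

Definition chat (R : realType) (c : R) : nat :=
  `|Num.max (- Num.floor c) 0|%N.

(* Only meaningful when c is not in {0, -1, -2, ...}: then the denominator
   is nonzero for every n. *)
Definition admissible (R : realType) (c : R) (F1 F2 : {fset nat}) : Prop :=
  forall n : nat,
    0 <= (\prod_(f <- enum_fset F1) (n%:R - f%:R)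
          * \prod_(f <- enum_fset F2) (n%:R + c + f%:R))
         / pochhammer (n%:R + c) (chat c).

(* Main.v *)
(* Put a = alpha + 1.  L_n^alpha satisfies x y'' + (a - x) y' + n y = 0, and the
   seeds L_f^alpha (f in F1) and e^x L_f^alpha(-x) (f in F2) satisfy the same
   equation with n replaced by f and by -(f + a).  Omega is, up to a power of
   e^x, the Wronskian of the seeds, so the monic operator A of order k killing
   them has coefficients in R[x] / Omega.  Composing k Darboux steps gives, for
   p = L_n^alpha and C = prod (n - f) prod (n + a + f),
     x^k (A p)^2 - C p^2 = x^(1-a) e^x (x^a e^(-x) G)'
   with G rational and regular at 0; likewise p^2 is, modulo such derivatives, a
   positive multiple of x^M / ((a + n) ... (a + M - 1)) for all M >= n.  If
   admissibility failed at n, then (x^a e^(-x) G)' would be x^(a-1) e^(-x) times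
   x^k (A p)^2 + t x^M with t > 0, hence positive on (0, oo).  When Omega has no
   zero on [0, oo), G has no pole there, G vanishes at 0 to order at least k, and
   a + k > 0, so x^a e^(-x) G would be a strictly increasing function tending to
   0 both at 0 and at infinity.  Positivity forces G > 0 near 0 and G < 0 near
   infinity, while G can only cross zero upwards; this turns the contradiction
   into a statement on polynomials, free of real powers and exponentials. *)
Require Import Defs.
From HB Require Import structures.
From mathcomp Require Import all_boot all_order all_algebra.
From mathcomp Require Import finmap reals.
From mathcomp Require Import polyorder polyrcf zify ring.

Set Implicit Arguments.
Unset Strict Implicit.
Unset Printing Implicit Defensive.

Import Order.TTheory GRing.Theory Num.Theory.

Local Open Scope ring_scope.

(** * Positivity of a weighted derivative *)

(** Induction on the size. At a root [c] write [p = r * (x - c)]. If [r.[c] <= 0] then [c] works;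
    otherwise [r] is positive at [c] and negative at [b], and a downward crossing of [r] beyond [c]
    is one of [p]. *)
Lemma poly_down_crossing (R : rcfType) (p : {poly R}) (a b : R) :
  a < b -> 0 < p.[a] -> p.[b] < 0 ->
  exists2 x, a < x < b & p.[x] = 0 /\ p^`().[x] <= 0.
Proof.
have [n] := ubnP (size p); elim: n p a b => // n IHn p a b sz_p ab pa pb.
have [c] : {c | c \in `]a, b[ & root p c}.
  by apply: poly_ivtoo (ltW ab) _; rewrite pmulr_rlt0.
rewrite in_itv /= => /andP[ac cb] /factor_theorem[r def_p].
have dp x : p^`().[x] = r^`().[x] * (x - c) + r.[x].
  by rewrite def_p derivM derivXsubC mulr1 hornerD hornerM hornerXsubC.
have px x : p.[x] = r.[x] * (x - c) by rewrite def_p hornerM hornerXsubC.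
have [rc_le0 | rc_gt0] := lerP r.[c] 0.
  exists c; first by rewrite ac.
  by rewrite dp px subrr !mulr0 add0r.
have rb : r.[b] < 0 by move: pb; rewrite px pmulr_llt0 // subr_gt0.
have sz_r : (size r < n)%N.
  move: sz_p; rewrite def_p size_Mmonic ?monicXsubC ?size_XsubC ?addn2 //.
  by apply/eqP => r0; move: rb; rewrite r0 horner0 ltxx.
have [x /andP[cx xb] [rx drx]] := IHn r c b sz_r cb rc_gt0 rb.
exists x; first by rewrite (lt_trans ac cx).
by rewrite px dp rx mul0r addr0 mulr_le0_ge0 // subr_ge0 ltW.
Qed.

(* [x^(1-a) e^x (x^a e^(-x) P/D)' = wderiv_num a P D / D^2] *)
Definition wderiv_num (R : nzRingType) (a : R) (P D : {poly R}) : {poly R} :=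
  a *: (P * D) + 'X * (P^`() * D - P * D^`()) - 'X * P * D.

Lemma wderiv_numMM (R : comNzRingType) (a : R) (g P D : {poly R}) :
  wderiv_num a (g * P) (g * D) = g ^+ 2 * wderiv_num a P D.
Proof. rewrite /wderiv_num !derivM -!mul_polyC; ring. Qed.

Lemma wderiv_numXn (R : comNzRingType) (a : R) (m : nat) (P D : {poly R}) :
  wderiv_num a ('X^m * P) D = 'X^m * wderiv_num (a + m%:R) P D.
Proof.
rewrite /wderiv_num !derivM derivXn scalerDl scaler_nat.
rewrite -!mul_polyC; case: m => [|m]; first by rewrite mulr0n; ring.
rewrite exprS /=; ring.
Qed.

Section PositiveCombination.
Variables (R : rcfType) (a t : R) (k M : nat) (Om N : {poly R}).
Hypothesis a_reg : forall m : nat, a + m%:R != 0.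
Hypothesis ak_gt0 : 0 < a + k%:R.
Hypothesis t_gt0 : 0 < t.
Hypothesis le_kM : (k <= M)%N.
Hypothesis Om_neq0 : forall x : R, 0 <= x -> Om.[x] != 0.

Let rhs := 'X^k * N ^+ 2 + t *: ('X^M * Om ^+ 2).

Lemma rhs_gt0 (x : R) : 0 < x -> 0 < rhs.[x].
Proof.
move=> x0; rewrite hornerD hornerZ ![(_ * _).[x]]hornerM !horner_exp hornerX.
apply: ltr_wpDl; first by rewrite mulr_ge0 ?sqr_ge0 ?exprn_ge0 ?ltW.
have Om2_gt0 : 0 < Om.[x] ^+ 2 by rewrite exprn_even_gt0 //= Om_neq0 ?ltW.
by rewrite mulr_gt0 // mulr_gt0 // exprn_gt0.
Qed.

Section Reduced.
Variables P D : {poly R}.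
Hypothesis coPD : coprimep P D.
Hypothesis D0 : D.[0] != 0.
Hypothesis eqPD : wderiv_num a P D * Om ^+ 2 = D ^+ 2 * rhs.

(** By [eqPD] the weighted derivative of [P / D] is [rhs / Om^2], finite on [[0, oo)], whereas a
    pole of [P / D] at a positive point would give it a pole of higher order. *)
Lemma reduced_denom_neq0 (x : R) : 0 <= x -> D.[x] != 0.
Proof.
move=> x_ge0; apply/negP => Dx.
have x_neq0 : x != 0 by apply: contraNneq D0 => x0; move: Dx; rewrite x0.
have D_neq0 : D != 0 by apply: contraNneq D0 => ->; rewrite horner0.
pose c := 'X * P * Om ^+ 2.
have Px : P.[x] != 0.
  by apply/negP => Px; have := coprimep_root coPD Px; rewrite Dx.
have Nrc : ~~ root c x.
  rewrite /root [_.[x]]hornerM horner_exp [('X * P).[x]]hornerM hornerX.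
  exact: mulf_neq0 (mulf_neq0 x_neq0 Px) (expf_neq0 2 (Om_neq0 x_ge0)).
(* [eqPD] makes [D] divide [c * D^`()], although at a zero of [D] the derivative
   vanishes to a lower order and [c] does not vanish. *)
have DdvdD' : D %| c * D^`().
  have -> : c * D^`() = D * ((a *: P + 'X * P^`() - 'X * P) * Om ^+ 2 - D * rhs).
    by rewrite mulrBr [D * (D * _)]mulrA -[D * D]expr2 -eqPD
         /wderiv_num /c -!mul_polyC; ring.
  exact: dvdp_mulr.
have D'_neq0 : c * D^`() != 0.
  have := mu_deriv_root D_neq0 Dx; apply: contra_eq_neq => /eqP.
  rewrite mulf_eq0 => /orP[/eqP c0|/eqP d0].
    by move: Nrc; rewrite c0 root0.
  have : (1 < size D)%N by apply: root_size_gt1 Dx.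
  by rewrite -subn_gt0 subn1 -size_deriv d0 size_poly0.
have : (\mu_x D <= \mu_x (c * D^`()))%N.
  by rewrite -root_le_mu // (dvdp_trans (root_mu _ _)).
by rewrite mu_mul // (muNroot Nrc) (mu_deriv_root D_neq0 Dx) addn1 ltnn.
Qed.

Lemma no_reduced_positive_combination : False.
Proof.
have D_neq0 : D != 0 by apply: contraNneq D0 => ->; rewrite horner0.
have Om2_gt0 x : 0 <= x -> 0 < (Om ^+ 2).[x].
  by move=> x0; rewrite horner_exp exprn_even_gt0 //= Om_neq0.
have W_gt0 x : 0 < x -> 0 < (wderiv_num a P D).[x].
  move=> x0; rewrite -(pmulr_lgt0 _ (Om2_gt0 _ (ltW x0))) -hornerM eqPD.
  rewrite hornerM mulr_gt0 ?rhs_gt0 // horner_exp exprn_even_gt0 //=.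
  by rewrite reduced_denom_neq0 ?ltW.
have P_neq0 : P != 0.
  apply: contraTneq (W_gt0 1 ltr01) => ->.
  by rewrite /wderiv_num deriv0 !(mul0r, mulr0, scaler0, subr0, addr0) horner0 ltxx.
have [m [U [U0 defP]]] : exists m, exists U : {poly R}, U.[0] != 0 /\ P = 'X^m * U.
  have [U U0 defP] := mu_spec 0 P_neq0; exists (\mu_0 P), U.
  by split; rewrite // {1}defP subr0 mulrC.
have defW : wderiv_num a P D = 'X^m * wderiv_num (a + m%:R) U D.
  by rewrite defP wderiv_numXn.
have V0 : (wderiv_num (a + m%:R) U D).[0] = (a + m%:R) * (U.[0] * D.[0]).
  by rewrite /wderiv_num !hornerE /=; ring.
(* If [m < k], dividing by ['X^m] leaves a right side vanishing at 0, since [k <= M], and a left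
   side with nonzero value [(a + m) U(0) D(0) Om(0)^2]. *)
have le_km : (k <= m)%N.
  rewrite leqNgt; apply/negP => lt_mk.
  have Xm_neq0 : 'X^m != 0 :> {poly R} by rewrite -size_poly_eq0 size_polyXn.
  have : wderiv_num (a + m%:R) U D * Om ^+ 2 =
         D ^+ 2 * ('X^(k - m) * N ^+ 2 + t *: ('X^(M - m) * Om ^+ 2)).
    apply: (mulfI Xm_neq0); rewrite mulrA -defW eqPD /rhs.
    rewrite -{1}(subnKC (ltnW lt_mk)) -{1}(subnKC (leq_trans (ltnW lt_mk) le_kM)).
    by rewrite !exprD -!mul_polyC; ring.
  have Xn0 j (q : {poly R}) : (m < j)%N -> ('X^(j - m) * q).[0] = 0.
    by rewrite -subn_gt0 hornerM hornerXn expr0n => /lt0n_neq0/negPf->; rewrite mul0r.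
  move/(congr1 (fun p => p.[0])); rewrite !hornerM V0 hornerD hornerZ.
  rewrite (Xn0 k) // (Xn0 M) ?(leq_trans lt_mk) // !mulr0 addr0 mulr0.
  apply/eqP/mulf_neq0; last by rewrite mulf_neq0 ?Om_neq0.
  exact: mulf_neq0 (mulf_neq0 U0 D0).
have am_gt0 : 0 < a + m%:R by rewrite (lt_le_trans ak_gt0) // lerD2l ler_nat.
have V_gt0 x : 0 < x -> 0 < (wderiv_num (a + m%:R) U D).[x].
  move=> x0; have := W_gt0 x x0; rewrite defW hornerM hornerXn pmulr_rgt0 //.
  exact: exprn_gt0.
(* The weighted derivative of [U / D] has at 0 the sign of [U * D]; if negative there, it would have
   a zero in (0, 1). *)
have UD0 : 0 < (U * D).[0].
  rewrite lt_neqAle eq_sym hornerM mulf_neq0 //= leNgt; apply/negP => UD_lt0.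
  have V_lt0 : (wderiv_num (a + m%:R) U D).[0] < 0 by rewrite V0 pmulr_rlt0.
  have V01 : (wderiv_num (a + m%:R) U D).[0] * (wderiv_num (a + m%:R) U D).[1] < 0.
    by rewrite nmulr_rlt0 // V_gt0.
  have [x] := poly_ivtoo ler01 V01.
  rewrite in_itv /= => /andP[x0 _] /eqP Vx.
  by move: (V_gt0 x x0); rewrite Vx ltxx.
have U_neq0 : U != 0 by apply: contraNneq U0 => ->; rewrite horner0.
have UD_neq0 : U * D != 0 by rewrite mulf_neq0.
(* The term [- 'X * (U * D)] has the strictly largest degree, so positivity on the half-line forces
   [U * D] to be negative far out. *)
have V_lc : lead_coef (wderiv_num (a + m%:R) U D) = - lead_coef (U * D).
  have -> : wderiv_num (a + m%:R) U D =
    - ('X * (U * D)) + ((a + m%:R) *: (U * D) + 'X * (U^`() * D - U * D^`())).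
    by rewrite /wderiv_num; ring.
  rewrite lead_coefDl; first by rewrite lead_coefN mulrC lead_coefMX.
  rewrite size_polyN ['X * (U * D)]mulrC size_mulX //.
  have szU := lt_size_deriv U_neq0; have szD := lt_size_deriv D_neq0.
  have sz_dl := size_polyMleq U^`() D; have sz_dr := size_polyMleq U D^`().
  have sz_UD := size_mul U_neq0 D_neq0.
  have sz_diff : (size (U^`() * D - U * D^`())%R < size (U * D)%R)%N.
    apply: leq_ltn_trans (size_polyD _ _) _; rewrite size_polyN gtn_max.
    rewrite sz_UD (leq_ltn_trans sz_dl) ?(leq_ltn_trans sz_dr) //;
      by move: szU szD; clear; do 4!move: (size _); lia.
  rewrite ltnS (leq_trans (size_polyD _ _)) // geq_max size_scale_leq /= mulrC.
  have [->|nz] := eqVneq (U^`() * D - U * D^`()) 0; first by rewrite mul0r size_poly0.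
  by rewrite size_mulX.
have lc_lt0 : lead_coef (U * D) < 0.
  rewrite lt_neqAle lead_coef_eq0 UD_neq0 /= leNgt; apply/negP => lc_gt0.
  have [b Hb] : exists n, forall x, x >= n ->
      (- wderiv_num (a + m%:R) U D).[x] >= lead_coef (- wderiv_num (a + m%:R) U D).
    by apply: poly_pinfty_gt_lc; rewrite lead_coefN V_lc opprK.
  have := Hb (Num.max 1 b); rewrite le_max lexx orbT lead_coefN V_lc opprK => /(_ isT).
  rewrite leNgt hornerN (lt_trans _ lc_gt0) // oppr_lt0 V_gt0 //.
  by rewrite lt_max ltr01.
have [b b0 UDb] : exists2 b, 0 < b & (U * D).[b] < 0.
  have [b Hb] : exists n, forall x, x >= n ->
      (- (U * D)).[x] >= lead_coef (- (U * D)).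
    by apply: poly_pinfty_gt_lc; rewrite lead_coefN oppr_gt0.
  exists (Num.max 1 b); first by rewrite lt_max ltr01.
  rewrite -oppr_gt0 -hornerN (lt_le_trans _ (Hb _ _)) ?lead_coefN ?oppr_gt0 //.
  by rewrite le_max lexx orbT.
(* At the crossing [U] vanishes because [D] does not, so the weighted derivative there is
   [x * (U * D)'(x)]: positive, yet nonpositive. *)
have [x /andP[x0 _] [UDx]] := poly_down_crossing b0 UD0 UDb.
have Ux : U.[x] = 0.
  apply/eqP; move/eqP: UDx.
  by rewrite hornerM mulf_eq0 (negPf (reduced_denom_neq0 (ltW x0))) orbF.
rewrite derivM hornerD !hornerM Ux mul0r addr0 leNgt.
have := V_gt0 x x0.
have -> : (wderiv_num (a + m%:R) U D).[x] = x * (U^`().[x] * D.[x]).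
  by rewrite /wderiv_num !hornerE Ux /=; ring.
by rewrite pmulr_rgt0 // => ->.
Qed.
End Reduced.

Lemma no_positive_combination (P D : {poly R}) :
  D.[0] != 0 -> wderiv_num a P D * Om ^+ 2 <> D ^+ 2 * rhs.
Proof.
move=> D0 eqPD; pose g := gcdp P D.
have D_neq0 : D != 0 by apply: contraNneq D0 => ->; rewrite horner0.
have g_neq0 : g != 0 by rewrite gcdp_eq0 (negPf D_neq0) andbF.
have defP : P = g * (P %/ g) by rewrite mulrC divpK ?dvdp_gcdl.
have defD : D = g * (D %/ g) by rewrite mulrC divpK ?dvdp_gcdr.
apply: (@no_reduced_positive_combination (P %/ g) (D %/ g)).
- by apply: coprimep_div_gcd; rewrite D_neq0 orbT.
- by apply: contraNneq D0 => D'0; rewrite defD hornerM D'0 mulr0.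
apply: (mulfI (expf_neq0 2 g_neq0)).
have defD2 : D ^+ 2 = g ^+ 2 * (D %/ g) ^+ 2 by rewrite {1}defD exprMn.
by rewrite mulrA -wderiv_numMM -defP -defD eqPD defD2 -mulrA.
Qed.
End PositiveCombination.

Notation "p %:F" := (@FracField.tofrac _ p) : ring_scope.

(** * Darboux transformations over the field of rational functions *)

Lemma frac_numden (T : idomainType) (x : {fraction T}) :
  x = (\n_(repr x))%:F / (\d_(repr x))%:F.
Proof.
rewrite -[LHS]reprK -[in LHS](Ratio_numden (repr x)).
move: (\n_ _) (\d_ _) (denom_ratioP (repr x)) => n d d0.
rewrite -[(d%:F)^-1]/(FracField.inv d%:F); unlock FracField.tofrac.
rewrite -FracField.pi_inv -[RHS]FracField.pi_mul /FracField.mulf /FracField.invf.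
by rewrite !numden_Ratio ?oner_neq0 // mulr1 mul1r.
Qed.

(** Makes the quotient rule independent of the chosen fraction: primes are derivatives, and the
    second hypothesis is the first one differentiated. *)
Lemma quotient_rule_rep (T : comNzRingType) (n n' d d' m m' b b' : T) :
  n * b = m * d -> n' * b + n * b' = m' * d + m * d' ->
  (n' * d - n * d') * b ^+ 2 = (m' * b - m * b') * d ^+ 2.
Proof.
move=> E E'; apply/eqP; rewrite -subr_eq0; apply/eqP.
transitivity ((n' * b + n * b' - (m' * d + m * d')) * (b * d)
              - (n * b - m * d) * (b * d' + b' * d)); first by ring.
by rewrite E E' !subrr !mul0r subrr.
Qed.

Lemma quotient_ruleM (K : fieldType) (n d m b n' d' m' b' : K) :
  d != 0 -> b != 0 ->
  ((n' * m + n * m') * (d * b) - n * m * (d' * b + d * b')) / (d * b) ^+ 2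
  = (n' * d - n * d') / d ^+ 2 * (m / b) + n / d * ((m' * b - m * b') / b ^+ 2).
Proof. by move=> d0 b0; field; rewrite d0 b0. Qed.

Lemma quotient_ruleD (K : fieldType) (n d m b n' d' m' b' : K) :
  d != 0 -> b != 0 ->
  ((n' * b + n * b' + (m' * d + m * d')) * (d * b)
   - (n * b + m * d) * (d' * b + d * b')) / (d * b) ^+ 2
  = (n' * d - n * d') / d ^+ 2 + (m' * b - m * b') / b ^+ 2.
Proof. by move=> d0 b0; field; rewrite d0 b0. Qed.

(** Indices count derivatives, twisted ones for [y]. The hypotheses are the Riccati equation, the
    eigenvalue equation and the derivatives of both; the conclusion is a combination of the four. *)
Lemma darboux_SL (T : comNzRingType) (x a l l0 V V1 w w1 w2 y y1 y2 y3 : T) :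
  x * (w1 + w ^+ 2) + (a - x) * w + (l0 - V) = 0 ->
  x * y2 + (a - x) * y1 + (l - V) * y = 0 ->
  w1 + w ^+ 2 + x * (w2 + w * w1 *+ 2) - w + (a - x) * w1 - V1 = 0 ->
  y2 + x * y3 - y1 + (a - x) * y2 - V1 * y + (l - V) * y1 = 0 ->
  x * (y3 - w2 * y - w1 * y1 *+ 2 - w * y2) + (a + 1 - x) * (y2 - w1 * y - w * y1)
  + (l - (l0 + 1 - w - x * w1 + (a - x) * w + x * w ^+ 2)) * (y1 - w * y) = 0.
Proof.
set R0 := (X in X = 0 -> _); set E0 := (X in _ -> X = 0 -> _).
set R1 := (X in _ -> _ -> X = 0 -> _); set E1 := (X in _ -> _ -> _ -> X = 0 -> _).
move=> R0z E0z R1z E1z; transitivity (E1 - w * E0 - R0 * y1 + (w * R0 - R1) * y).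
  by rewrite /E1 /E0 /R0 /R1; ring.
by rewrite R0z E0z R1z E1z; ring.
Qed.

Lemma darboux_norm (T : comNzRingType) (x a l l0 V w w1 y y1 y2 : T) :
  x * (w1 + w ^+ 2) + (a - x) * w + (l0 - V) = 0 ->
  x * y2 + (a - x) * y1 + (l - V) * y = 0 ->
  x * (y1 - w * y) ^+ 2 = (l - l0) * y ^+ 2 +
   (a * (y * (y1 - w * y)) + x * (y1 * (y1 - w * y) + y * (y2 - (w1 * y + w * y1)))
    - x * (y * (y1 - w * y))).
Proof.
set R0 := (X in X = 0 -> _); set E0 := (X in _ -> X = 0 -> _) => R0z E0z.
apply/eqP; rewrite -subr_eq0; apply/eqP.
transitivity (R0 * y ^+ 2 - y * E0); first by rewrite /R0 /E0; ring.
by rewrite R0z E0z mulr0 mul0r subrr.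
Qed.

Fact fder_key : unit. Proof. exact: tt. Qed.

Lemma wderiv_quotient (K : fieldType) (a x p d p' d' : K) : d != 0 ->
  a * (p / d) + x * ((p' * d - p * d') / d ^+ 2) - x * (p / d)
  = (a * (p * d) + x * (p' * d - p * d') - x * p * d) / d ^+ 2.
Proof. by move=> d0; field. Qed.

Section FractionDerivation.
Variable F : fieldType.
Local Notation K := {fraction {poly F}}.
Implicit Types (p q n d : {poly F}) (u v w y : K) (c : F).

(* Locked, lest unification mistake [fder u] for a product. *)
Definition fder u : K := locked_with fder_key (
  let r := repr u in
  ((\n_r)^`() * \d_r - \n_r * (\d_r)^`())%:F / (\d_r)%:F ^+ 2).

Lemma fder_div n d : d != 0 ->
  fder (n%:F / d%:F) = (n^`() * d - n * d^`())%:F / d%:F ^+ 2.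
Proof.
move=> d0; rewrite /fder unlock; set r := repr _.
have r0 : \d_r != 0 by exact: denom_ratioP.
have := frac_numden (n%:F / d%:F); rewrite -/r => /esym/eqP.
rewrite eqr_div ?tofrac_eq0 // -!tofracM tofrac_eq => /eqP E.
have E' := congr1 (fun p => p^`()) E; rewrite !derivM in E'.
apply/eqP; rewrite eqr_div ?expf_neq0 ?tofrac_eq0 // -!tofracXn -!tofracM tofrac_eq.
by apply/eqP; exact: quotient_rule_rep E E'.
Qed.

Lemma fracP u : exists n d, d != 0 /\ u = n%:F / d%:F.
Proof.
by exists (\n_(repr u)), (\d_(repr u)); split; [exact: denom_ratioP|exact: frac_numden].
Qed.

Lemma fder_poly p : fder p%:F = p^`()%:F.
Proof.
have := fder_div p (oner_neq0 _).
by rewrite tofrac1 expr1n !divr1 mulr1 -[1]/(1%:P) derivC mulr0 subr0.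
Qed.

Lemma fderM u v : fder (u * v) = fder u * v + u * fder v.
Proof.
have [n [d [d0 ->]]] := fracP u; have [m [b [b0 ->]]] := fracP v.
rewrite mulf_div -!tofracM !fder_div ?mulf_neq0 // !derivM.
by rewrite !(tofracM, tofracB, tofracD) quotient_ruleM ?tofrac_eq0.
Qed.

Lemma fderD u v : fder (u + v) = fder u + fder v.
Proof.
have [n [d [d0 ->]]] := fracP u; have [m [b [b0 ->]]] := fracP v.
rewrite addf_div ?tofrac_eq0 // -!tofracM -tofracD !fder_div ?mulf_neq0 //.
by rewrite !(derivM, derivD) !(tofracM, tofracB, tofracD) quotient_ruleD ?tofrac_eq0.
Qed.

Lemma fderB : zmod_morphism fder.
Proof.
move=> u v; apply/eqP; rewrite eq_sym subr_eq -fderD subrK //.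
Qed.
HB.instance Definition _ := GRing.isZmodMorphism.Build K K fder fderB.

Lemma fderN u : fder (- u) = - fder u. Proof. exact: raddfN. Qed.

Lemma fder0 : fder 0 = 0. Proof. exact: raddf0. Qed.

Lemma fder_nat k : fder k%:R = 0.
Proof.
by rewrite -tofrac1 -tofracMn fder_poly derivMn -[1]/(1%:P) derivC mul0rn tofrac0.
Qed.

Lemma fder_const (c : F) : fder c%:P%:F = 0.
Proof. by rewrite fder_poly derivC tofrac0. Qed.

Lemma fderX : fder 'X%:F = 1.
Proof. by rewrite fder_poly derivX tofrac1. Qed.

(* [e^(-e x) (e^(e x) u)'] *)
Definition twist (e : nat) u : K := fder u + e%:R * u.

Lemma twistB e : zmod_morphism (twist e).
Proof. by move=> u v; rewrite /twist raddfB /= mulrBr opprD addrACA. Qed.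
HB.instance Definition _ e := GRing.isZmodMorphism.Build K K (twist e) (twistB e).

Lemma twistD e u v : twist e (u + v) = twist e u + twist e v.
Proof. exact: raddfD. Qed.

Lemma twist0 e : twist e 0 = 0.
Proof. exact: raddf0. Qed.

Lemma twistM e u y : twist e (u * y) = fder u * y + u * twist e y.
Proof. by rewrite /twist fderM; ring. Qed.

Lemma twistBM e w u y : twist e (u - w * y) = twist e u - fder w * y - w * twist e y.
Proof. by rewrite twistB twistM opprD addrA. Qed.

(* [x^(1-a) e^x (x^a e^(-x) u)'] *)
Definition wderiv (a : F) u : K := a%:P%:F * u + 'X%:F * fder u - 'X%:F * u.

Lemma wderivB a : zmod_morphism (wderiv a).
Proof. by move=> u v; rewrite /wderiv raddfB /=; ring. Qed.
HB.instance Definition _ a := GRing.isZmodMorphism.Build K K (wderiv a) (wderivB a).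

Lemma wderivD a u v : wderiv a (u + v) = wderiv a u + wderiv a v.
Proof. exact: raddfD. Qed.

Lemma wderivZ a (c : F) u : wderiv a (c%:P%:F * u) = c%:P%:F * wderiv a u.
Proof. by rewrite /wderiv fderM fder_const mul0r add0r; ring. Qed.

Lemma wderivXn a m u : wderiv a ('X^m%:F * u) = 'X^m%:F * wderiv (a + m%:R) u.
Proof.
rewrite /wderiv fderM fder_poly derivXn polyCD tofracD polyC_natr rmorph_nat.
case: m => [|m]; first by rewrite mulr0n tofrac0 expr0 tofrac1; ring.
rewrite exprS -mulr_natl [_.-1]/= !tofracM rmorph_nat.
move: (a%:P%:F) ('X%:F) ('X^m%:F) (fder u) => a' x xm u'; ring.
Qed.

(* The eigenvalue equation x y'' + (a - x) y' + (l - V) y = 0 for [e^(e x) y]. *)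
Definition SLeq e a l (V y : K) : Prop :=
  'X%:F * twist e (twist e y) + (a%:P%:F - 'X%:F) * twist e y + (l%:P%:F - V) * y = 0.

(* The equation satisfied by the logarithmic derivatives [w] of the solutions of
   [SLeq e a l V], whatever the twist [e]. *)
Definition riccati a l (V w : K) : Prop :=
  'X%:F * (fder w + w ^+ 2) + (a%:P%:F - 'X%:F) * w + (l%:P%:F - V) = 0.

(** With [w * u = twist e u], the second twisted derivative of [u] is [(w' + w^2) u]; dividing by
    [u] removes [e], so both families of seeds are treated alike. *)
Lemma riccati_logderiv e a l V u : u != 0 -> SLeq e a l V u ->
  riccati a l V (twist e u / u).
Proof.
move=> u0 Hu; set w := _ / u.
have wu : w * u = twist e u by rewrite /w divfK.
have dw : twist e (twist e u) = fder w * u + w * twist e u by rewrite -{1}wu twistM.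
apply: (mulIf u0); rewrite mul0r -[RHS]Hu dw -wu; ring.
Qed.

(** One Darboux step. The new potential depends on neither [e] nor [l], so one operator transforms
    all eigenfunctions and the step can be iterated. *)
Lemma SLeq_darboux e a l l0 V w y : riccati a l0 V w -> SLeq e a l V y ->
  SLeq e (a + 1) l
    (l0%:P%:F + 1 - w - 'X%:F * fder w + (a%:P%:F - 'X%:F) * w + 'X%:F * w ^+ 2)
    (twist e y - w * y).
Proof.
rewrite /SLeq /riccati.
set y1 := twist e y; set y2 := twist e y1; set y3 := twist e y2.
set w1 := fder w; set w2 := fder w1; set V1 := fder V.
set x := 'X%:F; set a' := a%:P%:F => R0 E0.
have R1 : w1 + w ^+ 2 + x * (w2 + w * w1 *+ 2) - w + (a' - x) * w1 - V1 = 0.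
  rewrite -[RHS]fder0 -R0 !fderD !fderM !fderN !fderD.
  rewrite !fderN /x /a' !fderX !fder_const -/w1 -/w2 expr2 fderM -/w1; ring.
have E1 : y2 + x * y3 - y1 + (a' - x) * y2 - V1 * y + (l%:P%:F - V) * y1 = 0.
  rewrite -[RHS](twist0 e) -E0 !twistD !twistM !fderD !fderN.
  rewrite /x /a' !fderX !fder_const -/y1 -/y2 -/y3 -/V1; ring.
have -> : twist e (twist e (y1 - w * y)) = y3 - w2 * y - w1 * y1 *+ 2 - w * y2.
  by rewrite (twistBM e w y1 y) (twistBM e w (y2 - w1 * y) y1) (twistBM e w1 y2 y); ring.
have -> : twist e (y1 - w * y) = y2 - w1 * y - w * y1.
  exact: twistBM.
rewrite polyCD tofracD tofrac1 -/a'.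
exact: darboux_SL R0 E0 R1 E1.
Qed.

(** Source of the product of eigenvalue differences: each step contributes one factor [l - l0]. *)
Lemma wderiv_darboux a l l0 V w y : riccati a l0 V w -> SLeq 0 a l V y ->
  'X%:F * (fder y - w * y) ^+ 2 =
  (l%:P%:F - l0%:P%:F) * y ^+ 2 + wderiv a (y * (fder y - w * y)).
Proof.
rewrite /SLeq /riccati /wderiv fderM fderD fderN fderM /twist !mul0r !addr0.
by move=> R0 E0; exact: darboux_norm R0 E0.
Qed.

(** * Polynomial solutions of the twisted equation *)

Definition ptwist (e : nat) p : {poly F} := p^`() + e%:R *: p.

Lemma ptwistB e : zmod_morphism (ptwist e).
Proof. by move=> p q; rewrite /ptwist derivB scalerBr opprD addrACA. Qed.
HB.instance Definition _ e :=
  GRing.isZmodMorphism.Build {poly F} {poly F} (ptwist e) (ptwistB e).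

Lemma ptwistD e p q : ptwist e (p + q) = ptwist e p + ptwist e q.
Proof. exact: raddfD. Qed.

Lemma ptwist0 e : ptwist e 0 = 0.
Proof. exact: raddf0. Qed.

Lemma ptwistM e p q : ptwist e (p * q) = p^`() * q + p * ptwist e q.
Proof. by rewrite /ptwist derivM mulrDr scalerAr addrA. Qed.

Lemma twist_poly e p : twist e p%:F = (ptwist e p)%:F.
Proof.
by rewrite /twist fder_poly /ptwist tofracD -mul_polyC polyC_natr tofracM rmorph_nat.
Qed.

Lemma iter_twist_poly e i p : iter i (twist e) p%:F = (iter i (ptwist e) p)%:F.
Proof. by elim: i => //= i ->; rewrite twist_poly. Qed.

Definition PSLeq e a l p : Prop :=
  'X * ptwist e (ptwist e p) + (a%:P - 'X) * ptwist e p + l%:P * p = 0.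

Lemma PSLeq_SLeq e a l p : PSLeq e a l p -> SLeq e a l 0 p%:F.
Proof.
rewrite /PSLeq /SLeq !twist_poly subr0 => /(congr1 (fun p => p%:F)).
by rewrite !(tofracB, tofracD, tofracM) tofrac0.
Qed.

Lemma PSLeq_ptwist e a l p : PSLeq e a l p -> PSLeq e (a + 1) (l - 1) (ptwist e p).
Proof.
rewrite /PSLeq => /(congr1 (ptwist e)).
rewrite ptwist0 (ptwistD e _ (l%:P * p)) (ptwistD e ('X * _)).
rewrite (ptwistM e 'X) (ptwistM e (a%:P - 'X)) (ptwistM e l%:P).
rewrite derivB !derivC derivX polyCD polyCB => H.
by rewrite -[RHS]H; ring.
Qed.

Lemma PSLeq_iter e a l p i : PSLeq e a l p ->
  PSLeq e (a + i%:R) (l - i%:R) (iter i (ptwist e) p).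
Proof.
move=> Hp; elim: i => [|i IHi]; first by rewrite addr0 subr0.
by rewrite -natr1 opprD !addrA; apply: PSLeq_ptwist.
Qed.

(** At 0 the second-order term drops out, leaving [(a + i) y_(i+1)(0) = (i - l) y_i(0)] for the
    twisted derivatives [y_i]. *)
Lemma PSLeq_iter_horner0 e a l p i : (forall m, a + m%:R != 0) -> PSLeq e a l p ->
  (iter i (ptwist e) p).[0] = p.[0] * \prod_(j < i) ((j%:R - l) / (a + j%:R)).
Proof.
move=> a_reg Hp; elim: i => [|i IHi]; first by rewrite big_ord0 mulr1.
have := congr1 (fun p => p.[0]) (PSLeq_iter i Hp).
rewrite big_ord_recr mulrA -IHi /= !hornerE /= => H.
apply: (mulfI (a_reg i)); rewrite [RHS]mulrC divfK //.
by apply/eqP; rewrite -subr_eq0; apply/eqP; rewrite -[RHS]H; ring.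
Qed.

(* [u] is regular at [0] with value [c] *)
Definition germ0 u (c : F) : Prop :=
  exists n d, [/\ d.[0] != 0, u = n%:F / d%:F & c = n.[0] / d.[0]].

Lemma horner0_neq0 d : d.[0] != 0 -> d != 0.
Proof. by apply: contraNneq => ->; rewrite horner0. Qed.

Lemma germ0_poly p : germ0 p%:F p.[0].
Proof. by exists p, 1; rewrite tofrac1 hornerC !divr1; split=> //; apply: oner_neq0. Qed.

Lemma germ0D u u' c c' : germ0 u c -> germ0 u' c' -> germ0 (u + u') (c + c').
Proof.
move=> [n [d [d0 -> ->]]] [m [b [b0 -> ->]]].
exists (n * b + m * d), (d * b); split; first by rewrite hornerM mulf_neq0.
  by rewrite addf_div ?tofrac_eq0 ?horner0_neq0 // -!tofracM -tofracD.
by rewrite addf_div // hornerD !hornerM.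
Qed.

Lemma germ0M u u' c c' : germ0 u c -> germ0 u' c' -> germ0 (u * u') (c * c').
Proof.
move=> [n [d [d0 -> ->]]] [m [b [b0 -> ->]]].
exists (n * m), (d * b); split; first by rewrite hornerM mulf_neq0.
  by rewrite mulf_div -!tofracM.
by rewrite mulf_div !hornerM.
Qed.

Lemma germ0N u c : germ0 u c -> germ0 (- u) (- c).
Proof.
by move=> [n [d [d0 -> ->]]]; exists (- n), d; rewrite tofracN hornerN !mulNr.
Qed.

Lemma germ0V u c : germ0 u c -> c != 0 -> germ0 u^-1 c^-1.
Proof.
move=> [n [d [d0 -> ->]]] c0; exists d, n; split; rewrite ?invf_div //.
by apply: contraNneq c0 => ->; rewrite mul0r.
Qed.

Lemma germ00 c : germ0 0 c -> c = 0.
Proof.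
move=> [n [d [d0 /esym/eqP + ->]]]; rewrite mulf_eq0 invr_eq0 !tofrac_eq0.
by rewrite (negPf (horner0_neq0 d0)) orbF => /eqP ->; rewrite horner0 mul0r.
Qed.

Lemma germ0_sum (I : Type) (r : seq I) (f : I -> K) (g : I -> F) :
  (forall i, germ0 (f i) (g i)) -> germ0 (\sum_(i <- r) f i) (\sum_(i <- r) g i).
Proof.
move=> H; elim: r => [|i r IHr]; last by rewrite !big_cons; apply: germ0D.
by rewrite !big_nil -tofrac0 -[X in germ0 _ X](horner0 0); apply: germ0_poly.
Qed.

Definition regular0 u : Prop := exists c, germ0 u c.

Lemma regular0_poly p : regular0 p%:F.
Proof. by exists p.[0]; apply: germ0_poly. Qed.

Lemma regular0D u v : regular0 u -> regular0 v -> regular0 (u + v).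
Proof. by move=> [b ub] [c vc]; exists (b + c); apply: germ0D. Qed.

Lemma regular0M u v : regular0 u -> regular0 v -> regular0 (u * v).
Proof. by move=> [b ub] [c vc]; exists (b * c); apply: germ0M. Qed.

Lemma regular0N u : regular0 u -> regular0 (- u).
Proof. by move=> [x ux]; exists (- x); apply: germ0N. Qed.

Lemma regular0B u v : regular0 u -> regular0 v -> regular0 (u - v).
Proof. by move=> ur vr; apply: regular0D => //; apply: regular0N. Qed.

Lemma regular0_fder u : regular0 u -> regular0 (fder u).
Proof.
move=> [_ [n [d [d0 -> _]]]]; rewrite fder_div ?horner0_neq0 //.
eexists; exists (n^`() * d - n * d^`()), (d ^+ 2); split; rewrite ?tofracXn //.
by rewrite horner_exp expf_neq0.
Qed.

Lemma regular0_twist e u : regular0 u -> regular0 (twist e u).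
Proof.
move=> ur; apply: regular0D; first exact: regular0_fder.
by apply: regular0M => //; rewrite -tofrac1 -tofracMn; apply: regular0_poly.
Qed.
End FractionDerivation.

(** * The operator killing the seeds *)

Section NewtonIndependence.
Variables (F : fieldType) (a : F).
Hypothesis a_reg : forall m : nat, a + m%:R != 0.

(** Newton basis with nodes 0, 1, 2, ... in the eigenvalue [l]: its value at [l] is the factor of
    [PSLeq_iter_horner0], the [j]-th twisted derivative at 0 of a solution with value 1 there. *)
Definition newton_poly (j : nat) : {poly F} :=
  \prod_(i < j) ((a + i%:R)^-1 *: (i%:R%:P - 'X)).

Lemma size_newton_poly j : size (newton_poly j) = j.+1.
Proof.
rewrite /newton_poly; elim: j => [|j IHj]; first by rewrite big_ord0 size_poly1.
have szX : size ((a + j%:R)^-1 *: (j%:R%:P - 'X)) = 2%N.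
  by rewrite size_scale ?invr_eq0 // -opprB size_polyN size_XsubC.
rewrite big_ord_recr /= size_mul ?IHj ?szX ?addn2 //.
  by rewrite -size_poly_eq0 IHj.
by rewrite -size_poly_eq0 szX.
Qed.

Lemma newton_poly_horner j l :
  (newton_poly j).[l] = \prod_(i < j) ((i%:R - l) / (a + i%:R)).
Proof.
by rewrite horner_prod; apply: eq_bigr => i _; rewrite !hornerE /= mulrC.
Qed.

(** As a polynomial in [l] the sum has degree exactly [k], so it cannot vanish at more than [k]
    distinct points. *)
Lemma newton_sum_neq0 (k : nat) (c : nat -> F) (ls : seq F) :
  c k != 0 -> uniq ls -> (k < size ls)%N ->
  exists2 l, l \in ls & \sum_(j < k.+1) c j * \prod_(i < j) ((i%:R - l) / (a + i%:R)) != 0.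
Proof.
move=> ck uls sz_ls; pose q := \sum_(j < k.+1) c j *: newton_poly j.
have q_horner l : q.[l] = \sum_(j < k.+1) c j * \prod_(i < j) ((i%:R - l) / (a + i%:R)).
  by rewrite horner_sum; apply: eq_bigr => j _; rewrite hornerZ newton_poly_horner.
have sz_q : size q = k.+1.
  rewrite /q big_ord_recr /= addrC size_polyDl ?size_scale ?size_newton_poly //.
  apply: (leq_ltn_trans (size_sum _ _ _)).
  by apply/bigmax_leqP => j _; rewrite (leq_trans (size_scale_leq _ _)) ?size_newton_poly.
have q_neq0 : q != 0 by rewrite -size_poly_eq0 sz_q.
have : ~~ all (root q) ls.
  by apply: contraTN sz_ls => q_ls; rewrite -leqNgt -ltnS -sz_q max_poly_roots.
by case/allPn => l ls_l ql; exists l => //; rewrite -q_horner.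
Qed.
End NewtonIndependence.

Section Crum.
Variable F : fieldType.
Local Notation K := {fraction {poly F}}.

(** The twist lets the same coefficients act on [e^(e x) y], with the exponential divided out. *)
Definition diffop (c : nat -> K) (k e : nat) (y : K) : K :=
  \sum_(i < k.+1) c i * iter i (twist e) y.

(* Coefficients of [(D - w) o diffop c k]. *)
Definition darboux_coef (c : nat -> K) (w : K) (i : nat) : K :=
  fder (c i) + (if i is j.+1 then c j else 0) - w * c i.

Lemma diffop_darboux c k w e y : (forall i, (k < i)%N -> c i = 0) ->
  diffop (darboux_coef c w) k.+1 e y = twist e (diffop c k e y) - w * diffop c k e y.
Proof.
move=> ck; rewrite /diffop raddf_sum /=.
under [in RHS]eq_bigr => i _ do rewrite twistM.
rewrite big_split /= mulr_sumr /darboux_coef.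
under eq_bigr => i _ do rewrite mulrBl mulrDl -mulrA.
rewrite big_split big_split /= sumrN; congr (_ + _ - _).
- by rewrite big_ord_recr /= (ck k.+1) // fder0 mul0r addr0.
- by rewrite big_ord_recl /= mul0r add0r.
by rewrite big_ord_recr /= (ck k.+1) // mul0r mulr0 addr0.
Qed.

Lemma regular0_diffop c k e y :
  (forall i, regular0 (c i)) -> regular0 y -> regular0 (diffop c k e y).
Proof.
move=> cr yr; rewrite /diffop; elim/big_ind: _.
- by rewrite -tofrac0; apply: regular0_poly.
- by move=> u v; apply: regular0D.
move=> i _; apply: regular0M => //; elim: (val i) => //= j; exact: regular0_twist.
Qed.

(* [(e, s, l)] stands for the seed function [e^(e x) s(x)] of eigenvalue [l]. *)
Definition seed := (nat * {poly F} * F)%type.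
Definition seed_twist (s : seed) := s.1.1.
Definition seed_poly (s : seed) := s.1.2.
Definition seed_eig (s : seed) := s.2.

(** Induction on the seeds. The operator for the tail sends the head seed to a solution [u] of the
    transformed equation; composing with the Darboux step of [u] kills the head too. Coefficients
    stay regular at 0 because [u] is nonzero there, by distinctness of the eigenvalues. *)
Lemma crum (a : F) (seeds : seq seed) :
  (forall m : nat, a + m%:R != 0) ->
  (forall s, s \in seeds -> PSLeq (seed_twist s) a (seed_eig s) (seed_poly s)) ->
  (forall s, s \in seeds -> (seed_poly s).[0] != 0) ->
  uniq [seq seed_eig s | s <- seeds] ->
  exists (c : nat -> K) (V : K),
  [/\ forall i, regular0 (c i),
      (forall i, (size seeds < i)%N -> c i = 0) /\ c (size seeds) = 1,
      forall s, s \in seeds -> diffop c (size seeds) (seed_twist s) (seed_poly s)%:F = 0,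
      forall e l y, SLeq e a l 0 y ->
        SLeq e (a + (size seeds)%:R) l V (diffop c (size seeds) e y)
    & forall l y, regular0 y -> SLeq 0 a l 0 y ->
      exists2 G, regular0 G & 'X^(size seeds)%:F * diffop c (size seeds) 0 y ^+ 2 =
        (\prod_(s <- seeds) (l - seed_eig s))%:P%:F * y ^+ 2 + wderiv a G].
Proof.
move=> a_reg; elim: seeds => [|s seeds IHs] SLs s0 /=.
  exists (fun i => (i == 0%N)%:R), 0; split=> //.
  - by case=> [|i]; rewrite /= -?tofrac1 -?tofrac0; apply: regular0_poly.
  - by split=> // -[].
  - by move=> e l y Hy; rewrite addr0 /diffop big_ord1 mul1r.
  move=> l y _ _; exists 0; first by rewrite -tofrac0; apply: regular0_poly.
  by rewrite big_nil expr0 !tofrac1 !mul1r raddf0 addr0 /diffop big_ord1 mul1r.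
move=> /andP[s_new uniq_l].
case: IHs => // [t ts|t ts|c [V [c_reg [c_big c_lead] c_seeds c_SL c_norm]]].
- by apply: SLs; rewrite inE ts orbT.
- by apply: s0; rewrite inE ts orbT.
set k := size seeds in c_big c_lead c_seeds c_SL c_norm *.
pose A := diffop c k; pose e := seed_twist s; pose u := A e (seed_poly s)%:F.
have [f cf] := fin_all_exists (fun i : 'I_k.+1 => c_reg i).
pose v j := f (inord j); have cv (i : 'I_k.+1) : germ0 (c i) (v i).
  by rewrite /v inord_val.
have vk : v k = 1.
  have := germ0D (cv ord_max) (germ0N (germ0_poly (1 : {poly F}))).
  by rewrite /= c_lead tofrac1 subrr hornerC => /germ00/eqP; rewrite subr_eq0 => /eqP.
have A_germ t : t \in s :: seeds ->
    germ0 (A (seed_twist t) (seed_poly t)%:F) ((seed_poly t).[0] *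
      \sum_(j < k.+1) v j * \prod_(i < j) ((i%:R - seed_eig t) / (a + i%:R))).
  move=> ts; rewrite mulr_sumr /A /diffop.
  apply: germ0_sum => i; rewrite iter_twist_poly mulrCA; apply: germ0M => //.
  rewrite -(PSLeq_iter_horner0 _ a_reg (SLs _ ts)); exact: germ0_poly.
(* If [u] vanished at [0], then all seeds would give roots of one polynomial of
   degree [k] in the eigenvalue, but there are [k + 1] distinct eigenvalues. *)
have [w0 u_germ u0] : exists2 w0, germ0 u w0 & w0 != 0.
  eexists; first exact: A_germ (mem_head _ _).
  apply/negP => /eqP u00.
  have vk0 : v k != 0 by rewrite vk oner_neq0.
  have [||l] := @newton_sum_neq0 _ _ a_reg k v [seq seed_eig s | s <- s :: seeds] vk0.
  - by rewrite /= s_new.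
  - by rewrite size_map.
  case/mapP => t ts ->; apply/negP; rewrite negbK.
  rewrite -(mulrI_eq0 _ (mulfI (s0 _ ts))); apply/eqP.
  move: (ts) (A_germ _ ts); rewrite inE => /orP[/eqP -> _ //|/c_seeds].
  by rewrite -/A => ->; apply: germ00.
have u_neq0 : u != 0 by apply: contraNneq u0 => uz; move: u_germ; rewrite uz => /germ00 ->.
have u_reg : regular0 u by exists w0.
pose w := twist e u / u.
have w_reg : regular0 w.
  apply: regular0M; first exact: regular0_twist.
  by exists w0^-1; apply: germ0V.
have w_ric : riccati (a + k%:R) (seed_eig s) V w.
  apply: (riccati_logderiv u_neq0 (e := e)); apply: c_SL; apply: PSLeq_SLeq.
  exact: SLs (mem_head _ _).
eexists (darboux_coef c w), _; split.
- move=> i; apply: regular0B; last exact: regular0M.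
  apply: regular0D; first exact: regular0_fder.
  by case: i => [|i] //; rewrite -tofrac0; apply: regular0_poly.
- rewrite /darboux_coef; split=> [[|i] // lt_ki|].
    by rewrite !c_big ?(ltnW lt_ki) // fder0 mulr0 subr0 addr0.
  by rewrite c_big // c_lead fder0 mulr0 subr0 add0r.
- move=> t; rewrite inE diffop_darboux // => /orP[/eqP->|/c_seeds ->].
    by rewrite -/e -/A -/u /w divfK // subrr.
  by rewrite twist0 mulr0 subr0.
- move=> e' l y Hy; rewrite -natr1 addrA diffop_darboux //.
  exact: SLeq_darboux w_ric (c_SL _ _ _ Hy).
move=> l y yr Hy; have [G Gr HG] := c_norm l y yr Hy.
pose z := A 0%N y; pose z1 := fder z - w * z.
have zr : regular0 z by exact: regular0_diffop.
have z1r : regular0 z1.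
  by apply: regular0B; [apply: regular0_fder|apply: regular0M].
(* The old identity is multiplied by the new factor; the Darboux step, taken at parameter [a + k],
   adds [z * z1], which [wderivXn] brings back to parameter [a] through the factor ['X^k]. *)
exists ((l - seed_eig s)%:P%:F * G + 'X^k%:F * (z * z1)).
  apply: regular0D; apply: regular0M => //; try exact: regular0_poly.
  exact: regular0M.
rewrite diffop_darboux // -/A -/z.
have -> : twist 0 z - w * z = z1 by rewrite /twist mul0r addr0.
rewrite exprSr tofracM -mulrA (wderiv_darboux w_ric (c_SL _ _ _ Hy)) -/A -/z -/z1.
rewrite mulrDr mulrCA HG big_cons polyCM tofracM wderivD wderivZ wderivXn.
by rewrite polyCB tofracB mulrDr addrA mulrA.
Qed.
End Crum.

(** * Clearing denominators and reducing squares to powers of x *)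

Lemma norm_combination (K : fieldType) (C Xn XM p2 W2 W3 f kap b : K) :
  f != 0 -> kap != 0 -> Xn * b ^+ 2 = f * p2 + W2 -> kap * Xn = XM + W3 ->
  C * p2 = C * b ^+ 2 / (f * kap) * (XM + W3) - C / f * W2.
Proof.
(* [Xn] and [XM] stand for powers of x, [W2] and [W3] for weighted derivatives; [Xn] is eliminated
   between the two relations. *)
move=> f0 k0 H2 <-; have -> : p2 = (Xn * b ^+ 2 - W2) / f by rewrite H2 addrK mulrC mulKf.
by field; rewrite f0 k0.
Qed.

Section Reduction.
Variable F : fieldType.
Local Notation K := {fraction {poly F}}.
Local Notation toK := (@FracField.tofrac {poly F}).

(** Cramer's rule: the vanishing on the seeds is a linear system for the [c j] with [j < k], so
    multiplying by its determinant makes every coefficient a polynomial. *)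
Lemma diffop_cramer (k : nat) (c : nat -> K) (e : 'I_k -> nat) (s : 'I_k -> {poly F})
  (p : {poly F}) :
  c k = 1 -> (forall i, diffop c k (e i) (s i)%:F = 0) ->
  exists N : {poly F},
    (\det (\matrix_(i < k, j < k) iter j (ptwist (e i)) (s i)))%:F
      * diffop c k 0 p%:F = N%:F.
Proof.
move=> ck cs; set M := \matrix_(i, j) _.
pose b : 'cV[{poly F}]_k := \col_i iter k (ptwist (e i)) (s i).
have Mc : map_mx toK M *m (\col_j c j) = - map_mx toK b.
  apply/colP => i; rewrite !mxE; apply/eqP; rewrite -addr_eq0 -[X in _ == X](cs i).
  rewrite /diffop big_ord_recr ck mul1r /= iter_twist_poly; apply/eqP; congr (_ + _).
  by apply: eq_bigr => j _; rewrite !mxE iter_twist_poly mulrC.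
have dc : (\det M)%:F *: (\col_j c j) = map_mx toK (- (\adj M *m b)).
  rewrite -mul_scalar_mx -det_map_mx -mul_adj_mx -mulmxA Mc -map_mx_adj.
  by rewrite mulmxN map_mxN map_mxM.
exists (\sum_(i < k) (- (\adj M *m b)) i 0 * iter i (ptwist 0) p
        + \det M * iter k (ptwist 0) p).
rewrite /diffop big_ord_recr /= ck mul1r mulrDr iter_twist_poly tofracD tofracM.
congr (_ + _); rewrite [RHS]rmorph_sum [LHS]mulr_sumr /=; apply: eq_bigr => i _.
have := congr1 (fun v : 'cV_k => v i 0) dc; rewrite ![in LHS]mxE [in RHS]mxE => dci.
by rewrite mulrA dci iter_twist_poly tofracM.
Qed.

Lemma wderiv_div (a : F) (P D : {poly F}) : D != 0 ->
  wderiv a (P%:F / D%:F) = (wderiv_num a P D)%:F / D%:F ^+ 2.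
Proof.
move=> D0; have DF : D%:F != 0 by rewrite tofrac_eq0.
rewrite /wderiv fder_div // /wderiv_num -mul_polyC !(tofracB, tofracD, tofracM).
move: (a%:P%:F) ('X%:F) (P%:F) (D%:F) (P^`()%:F) (D^`()%:F) DF.
exact: wderiv_quotient.
Qed.

Lemma wderiv_monomial (a : F) m :
  wderiv a ('X^m%:F) = (a + m%:R)%:P%:F * 'X^m%:F - 'X^(m.+1)%:F.
Proof.
have := wderivXn a m 1; rewrite mulr1 => ->.
rewrite /wderiv (fder_nat F 1) mulr0 addr0 !mulr1.
by rewrite mulrBr exprSr tofracM mulrC.
Qed.

(** Iterates [(a + m) x^m = x^(m+1) + wderiv a (x^m)], the integration by parts behind the Gamma
    recursion. *)
Lemma Xn_shift (a : F) n j : exists G : {poly F},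
  (\prod_(i < j) (a + n%:R + i%:R))%:P%:F * 'X^n%:F = 'X^(n + j)%:F + wderiv a G%:F.
Proof.
elim: j => [|j [G IHj]].
  exists 0; rewrite big_ord0 addn0 tofrac1 mul1r.
  by rewrite tofrac0 [wderiv a 0]raddf0 addr0.
exists ((a + n%:R + j%:R)%:P * G + 'X^(n + j)).
rewrite big_ord_recr /= polyCM tofracM mulrAC IHj mulrDl tofracD tofracM wderivD wderivZ.
rewrite wderiv_monomial natrD addrA addnS; ring.
Qed.

Lemma iter_ptwist0 (p : {poly F}) i : iter i (ptwist 0) p = p^`(i).
Proof. by elim: i => // i /= ->; rewrite /ptwist scale0r addr0. Qed.

(** Differentiation is the Darboux step with [w = 0], given by the constant solution of eigenvalue
    0; the [j]-th derivative has eigenvalue [n - j], whence the falling factorial. *)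
Lemma deriv_norm (a : F) n (p : {poly F}) j : PSLeq 0 a n%:R p -> (j <= n)%N ->
  exists G : {poly F},
  'X^j%:F * (p^`(j))%:F ^+ 2 = (n ^_ j)%:R%:P%:F * p%:F ^+ 2 + wderiv a G%:F.
Proof.
move=> Hp; elim: j => [|j IHj] lt_jn.
  by exists 0; rewrite ffactn0 expr0 !tofrac1 tofrac0 [wderiv a 0]raddf0 !mul1r addr0.
have [G HG] := IHj (ltnW lt_jn).
have := PSLeq_iter j Hp; rewrite iter_ptwist0 => /PSLeq_SLeq Hj.
have ric : riccati (a + j%:R) 0 0 (0 : K).
  by rewrite /riccati fder0 tofrac0; ring.
have := wderiv_darboux ric Hj.
rewrite mul0r subr0 fder_poly -derivnS tofrac0 subr0 => Hd.
exists ((n%:R - j%:R)%:P * G + 'X^j * (p^`(j) * p^`(j.+1))).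
rewrite exprSr tofracM -mulrA Hd mulrDr mulrCA HG tofracD !tofracM wderivD wderivZ wderivXn.
rewrite ffactnSr natrM natrB ?(ltnW lt_jn) // polyCM tofracM; ring.
Qed.
End Reduction.

(** * The sign forced by the norm identity *)

Section CrumSign.
Variables (R : rcfType) (a : R) (seeds : seq (seed R)) (s_dflt : seed R) (k : nat).
Hypothesis sz_seeds : size seeds = k.
Hypothesis a_reg : forall m : nat, a + m%:R != 0.
Hypothesis ak_gt0 : 0 < a + k%:R.
Hypothesis seeds_SL : forall s, s \in seeds ->
  PSLeq (seed_twist s) a (seed_eig s) (seed_poly s).
Hypothesis seeds_neq0 : forall s, s \in seeds -> (seed_poly s).[0] != 0.
Hypothesis seeds_uniq : uniq [seq seed_eig s | s <- seeds].

Definition seed_wronskian : {poly R} :=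
  \det (\matrix_(i < k, j < k)
    iter j (ptwist (seed_twist (nth s_dflt seeds i))) (seed_poly (nth s_dflt seeds i))).

Hypothesis wronskian_neq0 : forall x : R, 0 <= x -> seed_wronskian.[x] != 0.

(** Combines, modulo weighted derivatives, the norm identity of [crum], [deriv_norm] down to the
    constant [b], and [Xn_shift] from [x^n] to [x^(n + j)]. A negative product would contradict
    [no_positive_combination] with [M = n + j]. *)
Lemma crum_norm_sign (n : nat) (p : {poly R}) (b : R) (j : nat) :
  PSLeq 0 a n%:R p -> p^`(n) = b%:P -> b != 0 -> (k <= n + j)%N ->
  0 <= (\prod_(s <- seeds) (n%:R - seed_eig s)) * \prod_(i < j) (a + n%:R + i%:R).
Proof.
move=> p_SL dp b0 le_kM; rewrite leNgt; apply/negP.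
set C := \prod_(s <- seeds) _; set kap := \prod_(i < j) _ => Ckap_lt0.
have [c [V [_ [_ c_lead] c_seeds _ c_norm]]] := crum a_reg seeds_SL seeds_neq0 seeds_uniq.
have [G1 G1_reg HG1] := c_norm _ _ (regular0_poly p) (PSLeq_SLeq p_SL).
rewrite sz_seeds -/C in c_lead c_seeds HG1.
have [N HN] : exists N : {poly R}, seed_wronskian%:F * diffop c k 0 p%:F = N%:F.
  apply: (diffop_cramer p c_lead) => i; apply: c_seeds.
  by rewrite mem_nth ?sz_seeds.
have [G2 HG2] := deriv_norm p_SL (leqnn n).
have [G3 HG3] := Xn_shift a n j; rewrite -/kap in HG3.
rewrite dp ffactnn in HG2.
(* [t] is minus the coefficient of [x^(n + j)] in the reduction of [C p^2]; it has the sign of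
   [- (C * kap)]. *)
pose nu := n`!%:R * kap; pose t := - (C * b ^+ 2 / nu).
have kap0 : kap != 0 by apply: contraTneq Ckap_lt0 => ->; rewrite mulr0 ltxx.
have f_gt0 : 0 < n`!%:R :> R by rewrite ltr0n fact_gt0.
have nu0 : nu != 0 by exact: mulf_neq0 (lt0r_neq0 f_gt0) kap0.
have t_gt0 : 0 < t.
  have -> : t = - (C * kap) * (b ^+ 2 / (n`!%:R * kap ^+ 2)).
    by rewrite /t /nu; field; rewrite kap0 lt0r_neq0.
  have b2 : 0 < b ^+ 2 by rewrite exprn_even_gt0.
  have kap2 : 0 < kap ^+ 2 by rewrite exprn_even_gt0.
  apply: mulr_gt0; first by rewrite oppr_gt0.
  exact: divr_gt0 b2 (mulr_gt0 f_gt0 kap2).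
have cst_div (x y : R) : (x / y)%:P%:F = x%:P%:F / y%:P%:F :> {fraction {poly R}}.
  exact: (fmorph_div (@FracField.tofrac {poly R} \o polyC)).
have cst_neq0 (x : R) : x != 0 -> x%:P%:F != 0 :> {fraction {poly R}}.
  by rewrite tofrac_eq0 polyC_eq0.
have [G G_reg HG] : exists2 G, regular0 G & wderiv a G =
    'X^k%:F * diffop c k 0 p%:F ^+ 2 + t%:P%:F * 'X^(n + j)%:F.
  exists (G1 - t%:P%:F * G3%:F - (C / n`!%:R)%:P%:F * G2%:F).
    by do 2?[apply: regular0B]; rewrite -?tofracM //; apply: regular0_poly.
  rewrite !wderivB !wderivZ HG1.
  have Hcomb := norm_combination C%:P%:F (cst_neq0 _ (lt0r_neq0 f_gt0))
    (cst_neq0 _ kap0) HG2 HG3.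
  rewrite /t polyCN tofracN !cst_div !(polyCM, tofracM) !mulNr.
  rewrite Hcomb expr2.
  move: (_ / (_ * _)) (C%:P%:F / _) (wderiv a G1) (wderiv a G2%:F) (wderiv a G3%:F).
  by move=> q r W1 W2 W3; ring.
have [_ [P [D [D0 defG _]]]] := G_reg.
have D_neq0 := horner0_neq0 D0.
have DF : D%:F ^+ 2 != 0 by rewrite expf_neq0 ?tofrac_eq0.
have HW : (wderiv_num a P D)%:F = wderiv a G * D%:F ^+ 2.
  by rewrite defG wderiv_div // divfK.
apply: (no_positive_combination (N := N) (P := P)
  a_reg ak_gt0 t_gt0 le_kM wronskian_neq0 D0).
apply/eqP; rewrite -tofrac_eq -mul_polyC; apply/eqP.
rewrite tofracM HW HG !(tofracM, tofracD, tofracXn) -HN.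
move: ('X%:F ^+ k) (diffop _ _ _ _) (t%:P%:F) ('X%:F ^+ (n + j)) (D%:F) (seed_wronskian%:F).
by move=> xk A t' xM d w; ring.
Qed.
End CrumSign.

(** * Laguerre polynomials *)

Section Laguerre.
Variable K : numFieldType.
Implicit Types (a alpha : K) (n j m : nat).

Lemma gbinom0 a : gbinom a 0 = 1.
Proof. by rewrite /gbinom big_ord0 divr1. Qed.

Lemma gbinomS a m : m.+1%:R * gbinom a m.+1 = (a - m%:R) * gbinom a m.
Proof.
rewrite /gbinom big_ord_recr /= factS natrM.
have : m`!%:R != 0 :> K by rewrite pnatr_eq0 -lt0n fact_gt0.
have : m.+1%:R != 0 :> K by rewrite pnatr_eq0.
move: (\prod_(i < m) _) m.+1%:R m`!%:R => P x y x0 y0.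
by field; rewrite x0 y0.
Qed.

Lemma gbinomDl1 a m : m.+1%:R * gbinom (a + 1) m.+1 = (a + 1) * gbinom a m.
Proof.
rewrite /gbinom big_ord_recl /= subr0 factS natrM.
have -> : \prod_(i < m) (a + 1 - (bump 0 i)%:R) = \prod_(i < m) (a - i%:R).
  by apply: eq_bigr => i _; rewrite /bump add1n -natr1; ring.
have : m`!%:R != 0 :> K by rewrite pnatr_eq0 -lt0n fact_gt0.
have : m.+1%:R != 0 :> K by rewrite pnatr_eq0.
move: (\prod_(i < m) _) m.+1%:R m`!%:R => P x y x0 y0.
by field; rewrite x0 y0.
Qed.

Lemma gbinom_pascal a m : gbinom (a + 1) m.+1 = gbinom a m.+1 + gbinom a m.
Proof.
have m0 : m.+1%:R != 0 :> K by rewrite pnatr_eq0.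
by apply: (mulfI m0); rewrite mulrDr gbinomDl1 gbinomS -natr1; ring.
Qed.

Lemma coef_laguerre n alpha j : (laguerre n alpha)`_j =
  if (j <= n)%N then (-1) ^+ j * ((j`!%:R)^-1 * gbinom (n%:R + alpha) (n - j)) else 0.
Proof.
have -> : laguerre n alpha = \poly_(i < n.+1)
   ((-1) ^+ i * ((i`!%:R)^-1 * gbinom (n%:R + alpha) (n - i))).
  rewrite poly_def /laguerre; apply: eq_bigr => i _.
  by rewrite (exprNn 'X) -(rmorph_sign (@polyC K)) mul_polyC scalerA mulrC.
by rewrite coef_poly ltnS.
Qed.

Lemma coef_comp_polyNX (R : comNzRingType) (p : {poly R}) j :
  (p \Po - 'X)`_j = (-1) ^+ j * p`_j.
Proof.
have -> : p \Po - 'X = \poly_(i < size p) ((-1) ^+ i * p`_i).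
  rewrite comp_polyE poly_def; apply: eq_bigr => i _.
  by rewrite (exprNn 'X) -(rmorph_sign (@polyC R)) mul_polyC scalerA mulrC.
by rewrite coef_poly; case: ltnP => // ?; rewrite nth_default // mulr0.
Qed.

Lemma coef_laguerreN n alpha j : (laguerre n alpha \Po (- 'X))`_j =
  if (j <= n)%N then (j`!%:R)^-1 * gbinom (n%:R + alpha) (n - j) else 0.
Proof.
by rewrite coef_comp_polyNX coef_laguerre; case: leqP; rewrite ?mulr0 // signrMK.
Qed.

(** By Pascal's rule, raising the parameter amounts to differentiating [e^x L_n^alpha(-x)]; this
    turns the second block of [Omega] into Wronskian rows. *)
Lemma laguerre_contiguous n alpha :
  ptwist 1 (laguerre n alpha \Po - 'X) = laguerre n (alpha + 1) \Po - 'X.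
Proof.
apply/polyP => j; rewrite /ptwist scale1r coefD coef_deriv !coef_laguerreN.
have fj : j`!%:R != 0 :> K by rewrite pnatr_eq0 -lt0n fact_gt0.
have [lt_jn|lt_nj|->] := ltngtP j n; last 2 first.
- by rewrite mul0rn addr0.
- by rewrite ?ltnn mul0rn add0r subnn !gbinom0.
have -> : (n - j = (n - j.+1).+1)%N by lia.
rewrite [_ + (alpha + 1)]addrA gbinom_pascal mulrDr [RHS]addrC; congr (_ + _).
move: (gbinom _ _) => g; rewrite -[LHS]mulr_natl factS natrM invfM !mulrA mulfV ?mul1r //.
by rewrite pnatr_eq0.
Qed.

Lemma laguerreN_iter n alpha j :
  iter j (ptwist 1) (laguerre n alpha \Po - 'X) = laguerre n (alpha + j%:R) \Po - 'X.
Proof.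
elim: j => [|j IHj] /=; first by rewrite addr0.
by rewrite IHj laguerre_contiguous -addrA natr1.
Qed.

Lemma PSLeq_laguerre n alpha : PSLeq 0 (alpha + 1) n%:R (laguerre n alpha).
Proof.
rewrite /PSLeq /ptwist !scale0r !addr0; set p := laguerre _ _.
apply/polyP => j; rewrite coef0 mulrBl !(coefD, coefN) !coefCM !coefXM !coef_deriv.
(* Coefficientwise the equation is this two-term recurrence. For [j > n] both coefficients are zero;
   for [j = n] the first coefficient and the factor [n - j] are. *)
have key : j.+1%:R * (j%:R + alpha + 1) * p`_j.+1 + (n%:R - j%:R) * p`_j = 0.
  rewrite !coef_laguerre; have [lt_jn|lt_nj|->] := ltngtP j n; last 2 first.
  - by rewrite !mulr0 addr0.
  - by rewrite ?ltnn subrr mulr0 mul0r addr0.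
  have fj : j`!%:R != 0 :> K by rewrite pnatr_eq0 -lt0n fact_gt0.
  have dn : (n - j = (n - j.+1).+1)%N by lia.
  have nj : n%:R - j%:R = (n - j.+1).+1%:R :> K by rewrite -dn natrB // ltnW.
  rewrite dn nj [X in _ + X]mulrCA [X in _ + _ * X]mulrCA gbinomS factS natrM.
  have -> : n%:R + alpha - (n - j.+1)%:R = j.+1%:R + alpha.
    by rewrite addrAC -natrB ?leq_subr // subKn.
  have j0 : j.+1%:R != 0 :> K by rewrite pnatr_eq0.
  move: (gbinom _ _) ((-1) ^+ j) (exprS (-1 : K) j) => g s ->.
  rewrite -addrA [alpha + 1]addrC addrA natr1; move: j`!%:R j.+1%:R fj j0 => x y x0 y0.
  by field; rewrite x0 y0.
clearbody p.
case: j key => [|j] key; rewrite /= -[RHS]key; first by ring.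
rewrite -[p`_j.+1 *+ _]mulr_natr -[p`_j.+2 *+ _ *+ _]mulr_natr -[p`_j.+2 *+ _]mulr_natr.
move: (j.+1%:R) (j.+2%:R) (n%:R) (p`_j.+1) (p`_j.+2) => x y z q r; ring.
Qed.

(** Substituting [-x] turns the drift [a - x] into [a + x], where [a = alpha + 1]; the factor [e^x]
    restores [a - x] and moves the eigenvalue to [-(n + a)]. *)
Lemma PSLeq_laguerreN n alpha :
  PSLeq 1 (alpha + 1) (- (n%:R + alpha + 1)) (laguerre n alpha \Po - 'X).
Proof.

have := congr1 (fun p => p \Po - 'X) (PSLeq_laguerre n alpha).
rewrite /PSLeq /ptwist !scale0r !addr0 !scale1r.
set p := laguerre _ _.
rewrite !(comp_polyB, comp_polyD, comp_polyM, comp_polyC, comp_polyX) => H.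
have dN (q : {poly K}) : (q \Po - 'X)^`() = - (q^`() \Po - 'X).
  by rewrite deriv_comp derivN derivX mulrN1.
rewrite !(derivD, derivN, dN) opprK.
by apply: oppr_inj; rewrite oppr0 -[RHS]H !(polyCN, polyCD); ring.
Qed.

Lemma laguerre_horner0_neq0 n alpha : (forall m, alpha <> - m.+1%:R) ->
  (laguerre n alpha).[0] != 0.
Proof.
move=> alphaN; rewrite horner_coef0 coef_laguerre /= mul1r fact0 invr1 mul1r subn0.
rewrite /gbinom mulf_neq0 ?invr_eq0 ?pnatr_eq0 -?lt0n ?fact_gt0 //.
(* Each factor is [alpha + (n - i)] with [n - i >= 1], which vanishes only at an excluded
   [alpha]. *)
apply/prodf_neq0 => i _; apply/eqP => /eqP.
rewrite addrAC -natrB ?(ltnW (ltn_ord i)) // addrC addr_eq0.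
have /subnSK <- := ltn_ord i; move/eqP; exact: alphaN.
Qed.

Lemma laguerreN_horner0 n alpha : (laguerre n alpha \Po - 'X).[0] = (laguerre n alpha).[0].
Proof. by rewrite horner_comp !hornerE oppr0. Qed.

Lemma derivn_laguerre n alpha : (laguerre n alpha)^`(n) = ((-1) ^+ n)%:P.
Proof.
apply/polyP => j; rewrite coef_derivn coefC coef_laguerre.
case: j => [|j]; last by rewrite addnS ltnNge leq_addr /= mul0rn.
rewrite addn0 leqnn subnn gbinom0 mulr1 ffactnn -[LHS]mulr_natr divfK //.
by rewrite pnatr_eq0 -lt0n fact_gt0.
Qed.
End Laguerre.

(** * Laguerre seeds and the determinant Omega *)

Section LaguerreSeeds.
Variables (R : realType) (alpha : R) (F1 F2 : {fset nat}).

Definition seed1 (f : nat) : seed R := (0%N, laguerre f alpha, f%:R).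

Definition seed2 (f : nat) : seed R :=
  (1%N, laguerre f alpha \Po - 'X, - (f%:R + alpha + 1)).

Definition laguerre_seeds : seq (seed R) :=
  [seq seed1 f | f <- incr_enum F1] ++ [seq seed2 f | f <- incr_enum F2].

Lemma size_incr_enum (G : {fset nat}) : size (incr_enum G) = #|` G|.
Proof. by rewrite size_sort. Qed.

Lemma size_laguerre_seeds : size laguerre_seeds = (#|` F1| + #|` F2|)%N.
Proof. by rewrite size_cat !size_map !size_incr_enum. Qed.

Lemma Omega_seed_wronskian :
  Omega alpha F1 F2 = seed_wronskian laguerre_seeds (seed1 0) (#|` F1| + #|` F2|).
Proof.
rewrite /Omega /seed_wronskian; congr (\det _); apply/matrixP => i j; rewrite !mxE.
case: splitP => l ->; rewrite mxE nth_cat size_map size_incr_enum.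
  by rewrite ltn_ord (nth_map 0%N) ?size_incr_enum // iter_ptwist0.
rewrite ltnNge leq_addr addKn /= (nth_map 0%N) ?size_incr_enum //.
by rewrite -[RHS]/(iter j (ptwist 1) (laguerre _ alpha \Po - 'X)) laguerreN_iter.
Qed.

Lemma laguerre_seedsP (P : seed R -> Prop) :
  (forall f, P (seed1 f)) -> (forall f, P (seed2 f)) ->
  forall s, s \in laguerre_seeds -> P s.
Proof. by move=> P1 P2 s; rewrite mem_cat => /orP[] /mapP[f _ ->]. Qed.

Hypothesis alpha_neq : forall m : nat, alpha <> - (m.+1)%:R.

(** A value common to both families, [f = -(g + alpha + 1)], would make [alpha] the excluded integer
    [-(f + g + 1)]. *)
Lemma uniq_laguerre_eigs : uniq [seq seed_eig s | s <- laguerre_seeds].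
Proof.
have uniq_enum (G : {fset nat}) : uniq (incr_enum G) by rewrite sort_uniq fset_uniq.
rewrite map_cat -!map_comp cat_uniq !map_inj_uniq ?uniq_enum /=; last first.
- by move=> f g /eqP; rewrite eqr_nat => /eqP.
- by move=> f g /oppr_inj/addIr/addIr/eqP; rewrite eqr_nat => /eqP.
rewrite andbT; apply/hasPn => _ /mapP[g _ ->]; apply/mapP => -[f _].
rewrite /seed_eig /= => E; apply: (alpha_neq (m := (f + g)%N)).
by rewrite -natr1 natrD -E; ring.
Qed.

Lemma prod_laguerre_eigs (n : nat) :
  \prod_(s <- laguerre_seeds) (n%:R - seed_eig s) =
  \prod_(f <- enum_fset F1) (n%:R - f%:R)
  * \prod_(f <- enum_fset F2) (n%:R + (alpha + 1) + f%:R).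
Proof.
rewrite big_cat !big_map /=; congr (_ * _).
  by apply: perm_big; rewrite perm_sort.
rewrite (perm_big (enum_fset F2)) ?perm_sort //=; apply: eq_bigr => f _.
by rewrite /seed_eig /=; ring.
Qed.
End LaguerreSeeds.

(** * Pochhammer signs and admissibility *)

Lemma chat_ge0 (R : realType) (c : R) : 0 <= c + (chat c)%:R.
Proof.
rewrite /chat; have [c0|c0] := lerP (- Num.floor c) 0.
  by rewrite absz0 addr0 (le_trans _ (floor_le c)) // ler0z -oppr_le0.
rewrite natr_absz gtr0_norm // rmorphN /= subr_ge0; exact: floor_le.
Qed.

Lemma divr_ge0_mul (R : realFieldType) (x y : R) : 0 <= x * y -> 0 <= x / y.
Proof.
have [->|y0] := eqVneq y 0; first by rewrite invr0.
move=> xy; have -> : x / y = x * y * y^-1 ^+ 2 by field.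
by rewrite mulr_ge0 ?sqr_ge0.
Qed.

Theorem theorem1p2 (R : realType) (F1 F2 : {fset nat}) (alpha : R)
  (F1_pos : forall f : nat, f \in F1 -> (0 < f)%N)
  (F2_pos : forall f : nat, f \in F2 -> (0 < f)%N)
  (alpha_neq : forall m : nat, alpha <> - (m.+1)%:R)
  (alpha_gt : -1 < alpha + (#|` F1| + #|` F2|)%:R)
  (Omega_neq0 : forall x : R, 0 <= x -> (Omega alpha F1 F2).[x] <> 0) :
  admissible (alpha + 1) F1 F2.
Proof.
move=> n; rewrite -prod_laguerre_eigs [n%:R + _]addrC; apply: divr_ge0_mul.
set k := (#|` F1| + #|` F2|)%N in alpha_gt; set h := chat _.
have a_reg m : alpha + 1 + m%:R != 0.
  apply/eqP => a0; apply: (alpha_neq m); apply/eqP.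
  by rewrite -addr_eq0 -natr1 -a0; apply/eqP; ring.
(* Taking [h + k] factors, not just the [h] of the Pochhammer symbol, ensures [k <= n + j] for every
   [n]; the [k] extra factors are positive and are split off. *)
have := @crum_norm_sign R (alpha + 1) (laguerre_seeds alpha F1 F2) (seed1 alpha 0) k
  (size_laguerre_seeds _ _ _) a_reg _ _ _ (uniq_laguerre_eigs _ _ alpha_neq) _
  n (laguerre n alpha) ((-1) ^+ n) (h + k).
rewrite big_split_ord /= mulrA pmulr_lge0.
  apply.
  - by rewrite addrAC -ltrBlDr sub0r.
  - by apply: laguerre_seedsP => f; [apply: PSLeq_laguerre|apply: PSLeq_laguerreN].
  - by apply: laguerre_seedsP => f;
      rewrite /seed_poly /= ?laguerreN_horner0; apply: laguerre_horner0_neq0.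
  - by move=> x x0; rewrite -Omega_seed_wronskian; apply/eqP/Omega_neq0.
  - exact: PSLeq_laguerre.
  - exact: derivn_laguerre.
  - by rewrite signr_eq0.
  - by rewrite addnA leq_addl.
(* Positivity of the extra factors: [alpha + 1 + h >= 0] by [chat_ge0], and [a_reg] excludes
   zero. *)
apply: prodr_gt0 => i _; rewrite lt_neqAle eq_sym.
rewrite -addrA -natrD a_reg !natrD addrCA addr_ge0 //.
by rewrite [h%:R + _]addrC addrCA addr_ge0 // chat_ge0.
Qed.
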